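(* Let $Y=(Y_1,\dots,Y_m)$ be a random vector whose coordinates are independent nonnegative random variables, and let $f:\mathbb{R}^m\to\mathbb{R}_{\ge 0}$ be a monotone, symmetric norm. Then $$f\bigl(\mathbb{E}[Y^\downarrow]\bigr)\;\le\;\mathbb{E}[f(Y)]\;\le\;28\cdot f\bigl(\mathbb{E}[Y^\downarrow]\bigr).$$
   Context: A norm $f$ on $\mathbb{R}^m$ is monotone if $f(x)\le f(y)$ whenever $0\le x\le y$ coordinatewise, and symmetric if $f(x)=f(x^\downarrow)$ for all $x\in\mathbb{R}^m_{\ge0}$, where $x^\downarrow$ denotes $x$ with its coordinates sorted in non-increasing order. For the random vector $Y$, $Y^\downarrow$ is the random vector of its order statistics ($Y^\downarrow_1$ is the largest coordinate, $Y^\downarrow_2$ the second largest, etc.), and $\mathbb{E}[Y^\downarrow]$ is the deterministic vector of their expectations. *)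

(* Defs.v *)
From HB Require Import structures.
From mathcomp Require Import all_boot all_order all_algebra.
From mathcomp Require Import all_classical all_reals all_analysis.

Set Implicit Arguments.
Unset Strict Implicit.
Unset Printing Implicit Defensive.

Import Order.TTheory GRing.Theory Num.Theory.
Import numFieldNormedType.Exports.

Local Open Scope classical_set_scope.
Local Open Scope ring_scope.

Record is_norm (R : realType) (m : nat) (f : 'rV[R]_m -> R) : Prop := IsNorm {
  norm_nonneg : forall x, 0 <= f x ;
  norm_eq0 : forall x, f x = 0 -> x = 0 ;
  norm_homogeneous : forall a x, f (a *: x) = `|a| * f x ;
  norm_triangle : forall x y, f (x + y) <= f x + f y }.

Definition monotone_norm (R : realType) (m : nat) (f : 'rV[R]_m -> R) : Prop :=
  forall x y : 'rV[R]_m,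
    (forall i, 0 <= x ord0 i) -> (forall i, x ord0 i <= y ord0 i) -> f x <= f y.

Definition sort_decreasing (R : realType) (m : nat) (x : 'rV[R]_m) : 'rV[R]_m :=
  \row_(j < m) nth 0 (sort >=%R [seq x ord0 i | i <- enum 'I_m]) j.

Definition symmetric_norm (R : realType) (m : nat) (f : 'rV[R]_m -> R) : Prop :=
  forall x : 'rV[R]_m, (forall i, 0 <= x ord0 i) -> f x = f (sort_decreasing x).

Definition mutually_independent d (T : measurableType d) (R : realType)
    (P : probability T R) (m : nat) (Y : 'I_m -> {RV P >-> R}) : Prop :=
  forall (J : {set 'I_m}) (B : 'I_m -> set R), (forall i, measurable (B i)) ->
    P (\bigcap_(i in [set` J]) Y i @^-1` B i)
      = (\prod_(i in J) P (Y i @^-1` B i))%E.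

Definition random_vector d (T : measurableType d) (R : realType)
    (P : probability T R) (m : nat) (Y : 'I_m -> {RV P >-> R}) (w : T) :
    'rV[R]_m := \row_(i < m) Y i w.

(* [fine] sends an infinite expectation to 0, so this is the vector of expected
   order statistics only when the coordinates of Y are integrable. *)
Definition expected_order_statistics d (T : measurableType d) (R : realType)
    (P : probability T R) (m : nat) (Y : 'I_m -> {RV P >-> R}) : 'rV[R]_m :=
  \row_(j < m)
    fine 'E_P[fun w => sort_decreasing (random_vector Y w) ord0 j].

(* Main.v *)
Require Import Defs.
From mathcomp Require Import all_boot all_order all_algebra.
From mathcomp Require Import all_classical all_reals all_analysis.
From mathcomp Require Import measurable_realfun ring lra.
Import Order.TTheory GRing.Theory Num.Theory.
Import numFieldNormedType.Exports.
Local Open Scope classical_set_scope.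
Local Open Scope ring_scope.

(* The lower bound is Jensen's inequality, obtained from a linear functional
   supporting [f] at [E Y^dec] (Hahn-Banach), together with [f Y = f Y^dec].

   For the upper bound let [mu_j = E Y^dec_j] and let [N t] be the number of
   coordinates of [Y] above [t].  By Markov, [N (2 mu_j) <= j] with probability
   at least 1/2 (ranks start at 0), so Chebyshev for sums of independent
   indicators forces [E N (2 mu_j) <= 2 (j + 1)].  Since
   [Var (N t) <= E N t], the squared relative deviations of [N (2 mu_j)] at the
   ranks [j + 1 = 2 ^ i] have expectations decaying geometrically in [i], so
   one random factor [W] with [E W <= 4] satisfies
   [N (2 mu_j) <= W (j + 1)] at all these ranks simultaneously.  Hence the
   decreasing rearrangement of [min (Y, 2 mu_0)] is a superposition of at most
   [2 W + 1] vectors dominated by rearrangements of [2 mu], and [f] of it is at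
   most [2 (2 W + 1) f mu].  The excess over [2 mu_0] costs at most
   [2 mu_0 f e_0 <= 2 f mu] in expectation, because each coordinate exceeds
   [2 mu_0] alone with conditional probability at least 1/2.  The total is
   [2 (2 * 4 + 1) + 2 = 20]. *)

(** * Order statistics and symmetric monotone norms *)

(** Past the end of [s] the default 0 of [nth] is not above [t], because [0 <= t]; so every rank [j]
    can be treated alike. *)
Lemma lt_nth_sorted_ge {R : realType} (s : seq R) (t : R) (j : nat) :
  sorted >=%R s -> 0 <= t ->
  (t < nth 0 s j) = (j < count (fun y => (t < y)%R) s)%N.
Proof.
move=> + t0; elim: s j => [|a s IH] j ss; first by rewrite nth_nil /= ltNge t0.
have ge_trans : transitive (>=%R : rel R) by move=> x y z /= h1 h2; exact: le_trans h2 h1.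
have al : all (>=%R a) s by exact: (order_path_min ge_trans ss).
have ss' : sorted >=%R s by exact: path_sorted ss.
case: (ltP t a) => ta /=.
  by rewrite ta; case: j => [|j] /=; rewrite ?ta // IH.
have -> : count (fun y => (t < y)%R) s = 0%N.
  apply/eqP; rewrite -leqn0 leqNgt -has_count; apply/hasPn => y ys /=.
  by rewrite -leNgt (le_trans _ ta) //; exact: (allP al).
rewrite (ltNge t a) ta; case: j => [|j] /=; first by rewrite ltNge ta.
suff h : nth 0 s j <= t by rewrite ltNge h.
case: (ltnP j (size s)) => js; last by rewrite nth_default.
by rewrite (le_trans _ ta) //; apply: (allP al); rewrite mem_nth.
Qed.

(** Ranks live in [nat], so that a rank such as [2 ^ i - 1] may exceed [m]; the value there is 0. *)
Definition order_stat {R : realType} {m : nat} (x : 'rV[R]_m) (j : nat) : R :=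
  nth 0 (sort >=%R [seq x ord0 i | i <- enum 'I_m]) j.

Definition count_above {R : realType} {m : nat} (x : 'rV[R]_m) (t : R) : nat :=
  #|[pred i : 'I_m | t < x ord0 i]|.

Lemma sorted_order_stat {R : realType} {m : nat} (x : 'rV[R]_m) :
  sorted >=%R (sort >=%R [seq x ord0 i | i <- enum 'I_m]).
Proof. by apply: sort_sorted => a b; exact: le_total. Qed.

Lemma lt_order_stat {R : realType} {m : nat} (x : 'rV[R]_m) (t : R) (j : nat) :
  0 <= t -> (t < order_stat x j) = (j < count_above x t)%N.
Proof.
move=> t0; rewrite /order_stat lt_nth_sorted_ge ?sorted_order_stat //.
rewrite count_sort count_map /count_above; congr (_ < _)%N.
by rewrite -sum1_count -sum1_card big_enum_cond; apply: eq_bigl => i; rewrite !inE.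
Qed.

Lemma sort_decreasingE {R : realType} {m : nat} (x : 'rV[R]_m) (j : 'I_m) :
  sort_decreasing x ord0 j = order_stat x j.
Proof. by rewrite mxE. Qed.

Lemma order_stat_ge0 {R : realType} {m : nat} (x : 'rV[R]_m) (j : nat) :
  (forall i, 0 <= x ord0 i) -> 0 <= order_stat x j.
Proof.
move=> x0; rewrite /order_stat; set s := sort _ _.
case: (ltnP j (size s)) => js; last by rewrite nth_default.
have := mem_nth 0 js; rewrite mem_sort => /mapP[i _ ->]; exact: x0.
Qed.

Lemma order_stat_nincr {R : realType} {m : nat} (x : 'rV[R]_m) (j k : nat) :
  (forall i, 0 <= x ord0 i) -> (j <= k)%N -> order_stat x k <= order_stat x j.
Proof.
move=> x0 jk; rewrite leNgt; apply/negP.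
have h := order_stat_ge0 x j x0; rewrite lt_order_stat // => kc.
have := leq_ltn_trans jk kc; rewrite -lt_order_stat // ltxx //.
Qed.

Lemma le_order_stat0 {R : realType} {m : nat} (x : 'rV[R]_m) (i : 'I_m) :
  (forall i, 0 <= x ord0 i) -> x ord0 i <= order_stat x 0.
Proof.
move=> x0; rewrite leNgt lt_neqAle; apply/negP => /andP[ne].
have h := order_stat_ge0 x 0 x0.
rewrite leNgt => /negP; apply; rewrite ltNge; apply/negP => le.
have : order_stat x 0 < order_stat x 0.
  rewrite lt_order_stat //; apply/card_gt0P; exists i.
  by rewrite inE lt_neqAle ne.
by rewrite ltxx.
Qed.

Section symmetric_monotone_norm.
Context {R : realType} {m : nat} {f : 'rV[R]_m -> R}.
Hypotheses (f_norm : is_norm f) (f_monotone : monotone_norm f)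
  (f_symmetric : symmetric_norm f).

Lemma norm_0 : f 0 = 0.
Proof. by rewrite -(scale0r 0) (norm_homogeneous f_norm) normr0 mul0r. Qed.

Lemma norm_sum (I : Type) (r : seq I) (x : I -> 'rV[R]_m) :
  f (\sum_(i <- r) x i) <= \sum_(i <- r) f (x i).
Proof.
elim: r => [|i r IH]; first by rewrite !big_nil norm_0.
rewrite !big_cons (le_trans (norm_triangle f_norm _ _)) //; exact: lerD.
Qed.

(** By [lt_order_stat], domination of the counts at all levels is coordinatewise domination after
    sorting. *)
Lemma le_norm_count_above (x y : 'rV[R]_m) :
  (forall i, 0 <= x ord0 i) -> (forall i, 0 <= y ord0 i) ->
  (forall t, 0 <= t -> (count_above x t <= count_above y t)%N) -> f x <= f y.
Proof.
move=> x0 y0 xy; rewrite (f_symmetric x) // (f_symmetric y) //.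
apply: f_monotone => j; rewrite !sort_decreasingE ?order_stat_ge0 //.
rewrite leNgt; apply/negP.
have h := order_stat_ge0 y j y0; rewrite lt_order_stat // => /leq_trans/(_ (xy _ h)).
by rewrite -lt_order_stat // ltxx.
Qed.

(* Splitting the ranks of [x] by their residue mod [K] gives [K] vectors, each
   of which is up to a permutation dominated by [v]. *)
Lemma norm_le_blocks (x : 'rV[R]_m) (v : nat -> R) (K : nat) :
  (forall i, 0 <= x ord0 i) -> (forall j, 0 <= v j) ->
  (forall n, (n < m)%N -> order_stat x n <= v (n %/ K)%N) -> (0 < K)%N ->
  f x <= K%:R * f (\row_(j < m) v j).
Proof.
move=> x0 v0 xv K0; rewrite f_symmetric //.
pose u (r : 'I_K) : 'rV[R]_m :=
  \row_(n < m) if (n %% K == r)%N then v (n %/ K)%N else 0.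
have le_u r : f (u r) <= f (\row_(j < m) v j).
  apply: le_norm_count_above => [i|i|t t0]; rewrite ?mxE //; first by case: ifP.
  have div_lt (n : 'I_m) : (n %/ K < m)%N by rewrite (leq_ltn_trans (leq_div _ _)).
  (* Division by [K] is injective on a residue class, so it embeds the entries of [u r] above [t]
     into those of [v]. *)
  rewrite /count_above -(@card_in_imset _ _ (fun n : 'I_m => Ordinal (div_lt n))).
    apply/subset_leq_card/fintype.subsetP => _ /imsetP[n + ->]; rewrite !inE !mxE /=.
    by case: ifP => // _; rewrite ltNge t0.
  move=> n1 n2; rewrite !inE !mxE; case: eqP => [e1|_]; last by rewrite (ltNge t 0) t0.
  case: eqP => [e2|_]; last by rewrite (ltNge t 0) t0.
  move=> _ _ [] e; apply/val_inj => /=.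
  by rewrite (divn_eq n1 K) (divn_eq n2 K) e e1 e2.
apply: (@le_trans _ _ (\sum_(r < K) f (u r))); last first.
  apply: (le_trans (ler_sum _ (fun r _ => le_u r))).
  by rewrite sumr_const card_ord mulr_natl.
apply: le_trans (norm_sum _ _ _); apply: f_monotone => n.
  by rewrite sort_decreasingE order_stat_ge0.
rewrite sort_decreasingE summxE (bigD1 (Ordinal (ltn_pmod n K0))) //= mxE /= eqxx.
rewrite (le_trans (xv n (ltn_ord n))) // lerDl sumr_ge0 // => r _.
by rewrite mxE; case: ifP.
Qed.

(** * Truncation of a vector and the cost of its excess *)

Definition unit_norm : R := f (\row_(j < m) (j == 0 :> nat)%:R).

(** Every basis vector has the same counts as the first one, so symmetry transfers the bound. *)
Lemma norm_delta_le (l : 'I_m) (a : R) : 0 <= a ->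
  f (a *: delta_mx ord0 l) <= a * unit_norm.
Proof.
move=> a0; rewrite (norm_homogeneous f_norm) ger0_norm // ler_wpM2l //.
have m0 : (0 < m)%N by exact: leq_ltn_trans (ltn_ord l).
apply: le_norm_count_above => [i|i|t t0]; rewrite ?mxE ?ler0n //.
have [t1|t1] := ltP t 1.
  apply: (@leq_trans #|pred1 l|).
    apply: subset_leq_card; apply/fintype.subsetP => i.
    by rewrite !inE mxE eqxx /=; case: eqP => // _; rewrite ltNge t0.
  by rewrite card1; apply/card_gt0P; exists (Ordinal m0); rewrite inE mxE /=.
rewrite (_ : count_above _ _ = 0%N) //; apply: eq_card0 => i; rewrite !inE mxE eqxx /= ltNge (le_trans _ t1) //.
by case: eqP.
Qed.

Lemma unit_norm_le (v : nat -> R) : (forall j, 0 <= v j) ->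
  v 0 * unit_norm <= f (\row_(j < m) v j).
Proof.
move=> v0; rewrite -[X in X * _](ger0_norm (v0 0%N)) -(norm_homogeneous f_norm).
apply: f_monotone => i; rewrite !mxE; first by rewrite mulr_ge0 ?ler0n.
by case: eqP => [->|_]; rewrite ?mulr1 ?mulr0.
Qed.

(** [y] is its truncation plus its excesses along the basis vectors, and each excess is paid for by
    [norm_delta_le]. *)
Lemma norm_truncate (y : 'rV[R]_m) (t : R) :
  f y <= f (\row_l Num.min (y ord0 l) t)
         + (\sum_l Num.max (y ord0 l - t) 0) * unit_norm.
Proof.
have split_y : y = \row_l Num.min (y ord0 l) t
         + \sum_l Num.max (y ord0 l - t) 0 *: delta_mx ord0 l.
  apply/rowP => i; rewrite !mxE summxE (bigD1 i) //= big1 => [|k ki]; last first.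
    by rewrite !mxE eqxx eq_sym (negbTE ki) mulr0.
  rewrite !mxE !eqxx mulr1 addr0; case: (lerP (y ord0 i) t) => h.
    by rewrite max_r ?addr0 // subr_le0.
  by rewrite max_l ?subr_ge0 1?ltW // subrKC.
rewrite [X in f X <= _]split_y (le_trans (norm_triangle f_norm _ _)) // lerD2l.
rewrite (le_trans (norm_sum _ _ _)) // mulr_suml ler_sum // => l _.
by apply: norm_delta_le; rewrite le_max lexx orbT.
Qed.

(* The counts are only controlled at the thresholds of dyadic rank; rounding a
   rank up to the next power of two costs the factor 2 in front of [W]. *)
Lemma norm_truncated_le (y : 'rV[R]_m) (v : nat -> R) (W : R) :
  (forall i, 0 <= y ord0 i) -> (forall j, 0 <= v j) ->
  (forall j k, (j <= k)%N -> v k <= v j) -> 0 <= W ->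
  (forall i, (i < m)%N -> (count_above y (v (2 ^ i).-1))%:R <= W * 2 ^+ i) ->
  f (\row_l Num.min (y ord0 l) (v 0)) <= (2 * W + 1) * f (\row_(j < m) v j).
Proof.
move=> y0 v0 v_nincr W0 yW; set y' := \row__ _.
(* The number of blocks: [2 * W <= K] makes the blocks long enough, [K <= 2 * W + 1] bounds the
   cost. *)
pose K := (Num.trunc (2 * W)).+1.
have y'0 i : 0 <= y' ord0 i by rewrite mxE le_min y0 v0.
have K_le : K%:R <= 2 * W + 1.
  by rewrite /K -natr1 lerD2r Num.Theory.truncn_le mulr_ge0.
have le_K : 2 * W <= K%:R by rewrite ltW // truncnS_gt.
apply: (@le_trans _ _ (K%:R * f (\row_(j < m) v j))); last first.
  by rewrite ler_wpM2r // (norm_nonneg f_norm).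
apply: norm_le_blocks => // n nm.
have count_y' t : (count_above y' t <= count_above y t)%N.
  rewrite subset_leq_card //; apply/fintype.subsetP => i.
  by rewrite !inE mxE lt_min => /andP[].
rewrite leNgt lt_order_stat // -leqNgt.
(* The first block needs no count, since truncation keeps all entries at most [v 0]. *)
case: (posnP (n %/ K)) => [->|j_gt0].
  rewrite (_ : count_above _ _ = 0%N) //; apply: eq_card0 => i.
  by rewrite !inE mxE lt_min ltxx andbF.
(* [2 ^ i] is the least power of two above [j], hence at most [2 * j]. The count above [v j] is then
   at most [W * 2 ^ i <= 2 * W * j <= K * j <= n]. *)
set j := (n %/ K)%N in j_gt0 *; pose i := up_log 2 j.+1.
have j_lt : (j < 2 ^ i)%N by exact: (@up_logP 2 j.+1).
have i_gt0 : (0 < i)%N by rewrite up_log_gt0.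
have i_le : (2 ^ i <= 2 * j)%N.
  have := @up_log_gtn 2 j.+1 isT j_gt0; rewrite -/i ltnS => h.
  by rewrite -(prednK i_gt0) expnS leq_mul2l.
have i_lt_m : (i < m)%N.
  have := @up_log_gtn 2 j.+1 isT j_gt0; rewrite -/i ltnS => h.
  rewrite -(prednK i_gt0) (leq_ltn_trans (leq_trans (ltn_expl _ _) h)) //.
  exact: leq_ltn_trans (leq_div _ _) nm.
rewrite (leq_trans (count_y' _)) // -(ler_nat R).
have le_count : (count_above y (v j) <= count_above y (v (2 ^ i).-1))%N.
  rewrite subset_leq_card //; apply/fintype.subsetP => l; rewrite !inE.
  by apply: le_lt_trans; apply: v_nincr; rewrite -ltnS prednK // expn_gt0.
rewrite (@le_trans _ _ (W * 2 ^+ i)) //.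
  by rewrite (le_trans _ (yW i i_lt_m)) // ler_nat.
rewrite (@le_trans _ _ (W * (2 * j)%:R)) ?ler_wpM2l // -?natrX ?ler_nat //.
rewrite natrM mulrA (mulrC W) (@le_trans _ _ (K%:R * j%:R)) ?ler_wpM2r ?ler0n //.
by rewrite -natrM ler_nat mulnC leq_trunc_div.
Qed.

End symmetric_monotone_norm.

(** * Supporting functionals of sublinear functions *)

Definition sublinear {R : realType} {V : lmodType R} (p : V -> R) : Prop :=
  (forall a x, 0 <= a -> p (a *: x) = a * p x) /\
  (forall x y, p (x + y) <= p x + p y).

Lemma sublinearN_ge {R : realType} {V : lmodType R} (p : V -> R) (x : V) :
  sublinear p -> - p x <= p (- x).
Proof.
move=> [pZ pD]; rewrite lerNl -subr_ge0 opprK addrC.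
have := pD x (- x); rewrite subrr.
by have := pZ 0 0 (lexx 0); rewrite scale0r mul0r => ->; rewrite addrC.
Qed.

(* The witness [inf_(t >= 0) (p (x + t v) - t p v)] is the largest sublinear
   [q <= p] with [q (- v) = - p v]. *)
Lemma sublinear_linear_along {R : realType} {V : lmodType R} (p : V -> R) (v : V) :
  sublinear p ->
  exists q, [/\ sublinear q, forall x, q x <= p x & q (- v) <= - p v].
Proof.
move=> p_sub; have [pZ pD] := p_sub.
pose E x := [set p (x + t *: v) - t * p v | t in [set t : R | 0 <= t]].
(* Subadditivity gives [t * p v <= p (x + t *: v) + p (- x)], so the infimum is that of a set
   bounded below. *)
have E_lb x : lbound (E x) (- p (- x)).
  move=> _ [t /= t0 <-]; rewrite -pZ //.
  by have := pD (x + t *: v) (- x); rewrite addrAC subrr add0r; lra.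
have E_inf x t : 0 <= t -> inf (E x) <= p (x + t *: v) - t * p v.
  by move=> t0; apply: ge_inf; [exists (- p (- x)); exact: E_lb | exists t].
have E_glb x c : (forall t, 0 <= t -> c <= p (x + t *: v) - t * p v) -> c <= inf (E x).
  move=> h; apply: lb_le_inf; first by exists (p (x + 0 *: v) - 0 * p v); exists 0 => /=.
  by move=> _ [t /= t0 <-]; exact: h.
have p0 : p 0 = 0 by have := pZ 0 0 (lexx 0); rewrite scale0r mul0r.
have E0 : inf (E 0) = 0.
  apply/eqP; rewrite eq_le; apply/andP; split.
    by have := E_inf 0 0 (lexx 0); rewrite scale0r addr0 mul0r subr0 p0.
  by apply: (E_glb) => t t0; rewrite add0r pZ // subrr.
exists (fun x => inf (E x)); split; first split.
(* The parameter [t] for [x] corresponds to [a * t] for [a *: x]; the converse inequality is this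
   one for [a^-1]. *)
- have leZ a x : 0 < a -> inf (E (a *: x)) <= a * inf (E x).
    move=> a0; rewrite -ler_pdivrMl //; apply: (E_glb) => t t0.
    rewrite ler_pdivrMl //; apply: (le_trans (E_inf _ (a * t) _)); first by rewrite mulr_ge0 // ltW.
    by rewrite -scalerA -scalerDr pZ ?(ltW a0) // mulrBr mulrA.
  move=> a x; rewrite le_eqVlt => /predU1P[<-|a0]; first by rewrite scale0r mul0r E0.
  apply/eqP; rewrite eq_le leZ //= -ler_pdivlMl //.
  rewrite -[X in inf (E X)](scale1r x) -(mulVf (lt0r_neq0 a0)) -scalerA.
  by rewrite leZ // invr_gt0.
- move=> x y; rewrite -lerBlDr; apply: (E_glb) => t t0.
  rewrite lerBlDr -lerBlDl; apply: (E_glb) => s s0.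
  rewrite lerBlDr; apply: (le_trans (E_inf _ (s + t) _)); first exact: addr_ge0.
  have := pD (x + t *: v) (y + s *: v).
  rewrite addrACA -scalerDl (addrC t s) mulrDl; lra.
- by move=> x; have := E_inf x 0 (lexx 0); rewrite scale0r addr0 mul0r subr0.
- by have := E_inf (- v) 1 ler01; rewrite scale1r addNr p0 mul1r sub0r.
Qed.

(** Linearity along [w] survives a further decrease from [q] to [r]:
    [r (- w) <= q (- w) <= - q w <= - r w]. *)
Lemma sublinear_linear_along_seq {R : realType} {V : lmodType R} (p : V -> R) (vs : seq V) :
  sublinear p ->
  exists q, [/\ sublinear q, forall x, q x <= p x &
    forall v, v \in vs -> q (- v) <= - q v].
Proof.
move=> p_sub; elim: vs => [|v vs [q [q_sub qp q_lin]]]; first by exists p.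
have [r [r_sub rq rv]] := sublinear_linear_along q v q_sub.
exists r; split=> // [x|w]; first exact: le_trans (rq x) (qp x).
rewrite inE => /predU1P[->|/q_lin qw]; first by rewrite (le_trans rv) // lerN2.
by rewrite (le_trans (rq _)) // (le_trans qw) // lerN2.
Qed.

(** Hahn-Banach in finite dimension: [p] is lowered first along [v], which preserves the value at
    [v], and then along each basis vector, which makes it linear. *)
Lemma sublinear_support {R : realType} {m : nat} (p : 'rV[R]_m -> R) (v : 'rV[R]_m) :
  sublinear p ->
  exists c : 'I_m -> R, (forall x : 'rV[R]_m, \sum_i c i * x ord0 i <= p x) /\
    p v <= \sum_i c i * v ord0 i.
Proof.
move=> p_sub.
have [q [q_sub qp qv]] := sublinear_linear_along p v p_sub.
have [r [r_sub rq r_lin]] :=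
  sublinear_linear_along_seq q [seq delta_mx ord0 i | i <- enum 'I_m] q_sub.
have [rZ rD] := r_sub.
have rN i : r (- delta_mx ord0 i) = - r (delta_mx ord0 i).
  apply/eqP; rewrite eq_le sublinearN_ge // r_lin //.
  by apply/mapP; exists i => //; rewrite mem_enum.
(* This one-sided bound suffices: applied to [- x] it also bounds the linear functional by [r x]. *)
have r_le x : r x <= \sum_i r (delta_mx ord0 i) * x ord0 i.
  rewrite {1}(row_sum_delta x).
  have r0 : r 0 = 0 by have := rZ 0 0 (lexx 0); rewrite scale0r mul0r.
  elim/big_ind2 : _ => [|a b c d ab cd|i _]; first by rewrite r0.
    by rewrite (le_trans (rD _ _)) // lerD.
  case: (lerP 0 (x ord0 i)) => xi; first by rewrite rZ // mulrC.
  rewrite -[_ *: _]opprK -scaleNr -scalerN rZ ?rN ?oppr_ge0 ?(ltW xi) //.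
  by rewrite mulrNN mulrC.
exists (fun i => r (delta_mx ord0 i)); split => [x|].
  rewrite -[X in p X](opprK x) (le_trans _ (le_trans (rq _) (qp _))) //.
  rewrite (le_trans _ (sublinearN_ge _ _ r_sub)) // lerNr -sumrN.
  by rewrite (le_trans (r_le _)) // ler_sum // => i _; rewrite mxE mulrN.
rewrite (le_trans _ (r_le v)) // -[v]opprK.
rewrite (le_trans _ (sublinearN_ge _ _ r_sub)) // lerNr opprK.
exact: le_trans (rq _) qv.
Qed.

(** * Expectations and counts of pairwise independent events *)

Section mean.
Context {d : measure_display} {T : measurableType d} {R : realType}
  (P : probability T R).
Implicit Types (X Z : T -> R) (A : set T).

Definition integ X : Prop := P.-integrable setT (EFin \o X).
Definition mean X : R := fine 'E_P[X]%E.

Lemma meanE X : mean X = Rintegral P setT X.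
Proof. by rewrite /mean unlock. Qed.

Lemma EFin_mean X : integ X -> (mean X)%:E = 'E_P[X]%E.
Proof. by move=> iX; rewrite /mean fineK // unlock; exact: integrable_fin_num. Qed.

Lemma integ_measurable X : integ X -> measurable_fun setT X.
Proof. by move=> /measurable_int/measurable_EFinP. Qed.

Lemma integ_cst (c : R) : integ (fun=> c).
Proof. exact: finite_measure_integrable_cst. Qed.

Lemma integD X Z : integ X -> integ Z -> integ (fun w => X w + Z w).
Proof. by move=> iX iZ; exact: (integrableD measurableT iX iZ). Qed.

Lemma integZ (c : R) X : integ X -> integ (fun w => c * X w).
Proof. by move=> iX; exact: (integrableZl measurableT c iX). Qed.

Lemma integ_sum (I : Type) (r : seq I) (X : I -> T -> R) :
  (forall i, integ (X i)) -> integ (fun w => \sum_(i <- r) X i w).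
Proof.
move=> iX; rewrite /integ (_ : _ \o _ = fun w => (\sum_(i <- r) (X i w)%:E)%E).
  by apply: (integrable_sum measurableT) => i _; exact: iX.
by apply/funext => w /=; rewrite sumEFin.
Qed.

Lemma le_integ X Z : measurable_fun setT X -> (forall w, 0 <= X w <= Z w) ->
  integ Z -> integ X.
Proof.
move=> mX XZ iZ; apply: (le_integrable measurableT _ _ iZ).
  exact/measurable_EFinP.
move=> w _ /=; rewrite lee_fin.
by case/andP: (XZ w) => X0 XZw; rewrite !ger0_norm // (le_trans X0).
Qed.

Lemma integ_indic A : measurable A -> integ \1_A.
Proof.
move=> mA; apply: (@le_integ _ (fun=> 1)); last exact: integ_cst.
  exact: measurable_indic.
by move=> w; rewrite indicE; case: (w \in A); rewrite ?lexx ?ler01.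
Qed.

Lemma mean_cst (c : R) : mean (fun=> c) = c.
Proof. by rewrite /mean (expectation_cst P). Qed.

Lemma meanD X Z : integ X -> integ Z -> mean (fun w => X w + Z w) = mean X + mean Z.
Proof. by move=> iX iZ; rewrite !meanE RintegralD. Qed.

Lemma meanZ (c : R) X : integ X -> mean (fun w => c * X w) = c * mean X.
Proof. by move=> iX; rewrite !meanE RintegralZl. Qed.

Lemma mean_sum (I : Type) (r : seq I) (X : I -> T -> R) :
  (forall i, integ (X i)) ->
  mean (fun w => \sum_(i <- r) X i w) = \sum_(i <- r) mean (X i).
Proof.
move=> iX; elim: r => [|i r IH].
  by rewrite big_nil; under [X in mean X]eq_fun do rewrite big_nil; rewrite mean_cst.
rewrite big_cons; under [X in mean X]eq_fun do rewrite big_cons.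
by rewrite meanD // ?IH //; exact: integ_sum.
Qed.

Lemma le_mean X Z : integ X -> integ Z -> (forall w, X w <= Z w) -> mean X <= mean Z.
Proof. by move=> iX iZ XZ; rewrite !meanE le_Rintegral. Qed.

Lemma mean_ge0 X : (forall w, 0 <= X w) -> 0 <= mean X.
Proof. by move=> X0; rewrite meanE Rintegral_ge0. Qed.

Lemma mean_indic A : measurable A -> mean \1_A = fine (P A).
Proof. by move=> mA; rewrite /mean expectation_indic. Qed.

Lemma mean_indicM_le X A (c : R) : integ X -> measurable A ->
  (forall w, 0 <= X w) -> (forall w, A w -> c <= X w) -> c * fine (P A) <= mean X.
Proof.
move=> iX mA X0 XA; rewrite -mean_indic // -meanZ; last exact: integ_indic.
apply: le_mean => //; first exact/integZ/integ_indic.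
move=> w; rewrite indicE; case: (boolP (w \in A)) => wA; last by rewrite mulr0.
by rewrite mulr1 XA //; exact: set_mem.
Qed.

Lemma measurable_set_gt X (c : R) :
  measurable_fun setT X -> measurable [set w | c < X w].
Proof.
move=> mX; have : measurable (setT `&` X @^-1` `]c, +oo[) by apply: mX.
rewrite setTI; congr measurable.
by apply/seteqP; split => w /=; rewrite in_itv /= andbT.
Qed.

Lemma measurable_set_le X (c : R) :
  measurable_fun setT X -> measurable [set w | X w <= c].
Proof.
move=> mX; have : measurable (setT `&` X @^-1` `]-oo, c]) by apply: mX.
by rewrite setTI; congr measurable.
Qed.

(** Markov's inequality, divided by the mean. If the mean is 0 this division fails, but then [X]
    vanishes almost everywhere and the strict inequality has probability 0. *)
Lemma prob_gt_twice_mean X : integ X -> (forall w, 0 <= X w) ->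
  fine (P [set w | 2 * mean X < X w]) <= 1 / 2.
Proof.
move=> iX X0; have mX := integ_measurable _ iX.
have mA : measurable [set w | 2 * mean X < X w].
  exact: measurable_set_gt.
have := mean_ge0 _ X0; rewrite le_eqVlt => /predU1P[EX0|EX0]; last first.
  have := mean_indicM_le X _ (2 * mean X) iX mA X0 (fun w => @ltW _ _ _ _).
  rewrite mulrAC -[leRHS]mul1r ler_pM2r //; lra.
suff -> : P [set w | 2 * mean X < X w] = 0%E by rewrite /= divr_ge0.
apply: measure_negligible => //.
have : (\int[P]_w `|(X w)%:E| = 0)%E.
  under eq_integral do rewrite gee0_abs ?lee_fin //.
  by have := EFin_mean _ iX; rewrite -EX0 unlock.
move/(ae_eq_integral_abs P measurableT (measurable_int _ iX)).1.
apply: negligibleS => w /=; rewrite -EX0 mulr0 => Xw /(_ I) [] /eqP.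
by rewrite gt_eqF.
Qed.

Lemma indicM (A B : set T) (w : T) : \1_A w * \1_B w = \1_(A `&` B) w :> R.
Proof. by rewrite !indicE in_setI -natrM mulnb. Qed.

(** The square expands into the products [G l k] of centred indicators. Pairwise independence kills
    the means off the diagonal, and a diagonal one is [p l - p l ^ 2 <= p l]. *)
Lemma variance_count_le (m : nat) (A : 'I_m -> set T) :
  (forall l, measurable (A l)) ->
  (forall l k, l != k -> P (A l `&` A k) = (P (A l) * P (A k))%E) ->
  let p l := fine (P (A l)) in
  let D w := (\sum_l \1_(A l) w - \sum_l p l) ^+ 2 in
  integ D /\ mean D <= \sum_l p l.
Proof.
move=> mA A_indep p D.
pose G l k w := \1_(A l `&` A k) w + (- p k * \1_(A l) w + (- p l * \1_(A k) w + p l * p k)).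
have mI l k : measurable (A l `&` A k) by exact: measurableI.
have iG2 l k : integ (fun w => - p l * \1_(A k) w + p l * p k).
  by apply: integD; [exact/integZ/integ_indic | exact: integ_cst].
have iG1 l k : integ (fun w => - p k * \1_(A l) w + (- p l * \1_(A k) w + p l * p k)).
  by apply: integD => //; exact/integZ/integ_indic.
have iG l k : integ (G l k) by apply: integD => //; exact: integ_indic.
have -> : D = fun w => \sum_l \sum_k G l k w.
  apply/funext => w; rewrite /D -sumrB expr2 mulr_suml; apply: eq_bigr => l _.
  by rewrite mulr_sumr; apply: eq_bigr => k _; rewrite /G -indicM; ring.
split; first by do 2!apply: integ_sum => ?.
rewrite mean_sum => [|l]; last exact: integ_sum.
apply: ler_sum => l _; rewrite mean_sum //.
have EG k : mean (G l k) = fine (P (A l `&` A k)) - p l * p k.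
  have iI j c : integ (fun w => c * \1_(A j) w) by exact/integZ/integ_indic.
  rewrite /G (meanD _ _ (integ_indic _ (mI l k)) (iG1 l k)).
  rewrite (meanD _ _ (iI _ _) (iG2 l k)) (meanD _ _ (iI _ _) (integ_cst _)).
  rewrite !(meanZ _ _ (integ_indic _ (mA _))).
  by rewrite mean_cst !mean_indic // /p; ring.
rewrite (bigD1 l) //= big1 => [|k kl].
  by rewrite addr0 EG setIid lerBlDr lerDl mulr_ge0 // fine_ge0.
by rewrite EG A_indep 1?eq_sym // fineM ?subrr // fin_num_measure.
Qed.

(** Chebyshev: if the sum [lam] exceeded [2 * (n + 1)], a count of at most [n] with probability 1/2
    would force [(lam - n) ^ 2 / 2 <= lam], which is false for such [lam]. *)
Lemma sum_prob_le (m n : nat) (A : 'I_m -> set T) :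
  (forall l, measurable (A l)) ->
  (forall l k, l != k -> P (A l `&` A k) = (P (A l) * P (A k))%E) ->
  1 / 2 <= fine (P [set w | \sum_l \1_(A l) w <= n%:R :> R]) ->
  \sum_l fine (P (A l)) <= 2 * n.+1%:R.
Proof.
move=> mA A_indep half; rewrite leNgt; apply/negP => lt_sum.
have [iD ED] := variance_count_le _ A mA A_indep.
set lam := \sum_l fine (P (A l)) in lt_sum iD ED.
have mS : measurable_fun setT (fun w => \sum_l \1_(A l) w : R).
  by apply: integ_measurable; apply: integ_sum => l; exact: integ_indic.
have mB : measurable [set w | \sum_l \1_(A l) w <= n%:R :> R].
  exact: measurable_set_le.
rewrite -natr1 in lt_sum; have n0 : 0 <= n%:R :> R := ler0n _ _.
have := mean_indicM_le _ _ ((lam - n%:R) ^+ 2) iD mB (fun w => sqr_ge0 _).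
have H w : \sum_l \1_(A l) w <= n%:R :> R ->
    (lam - n%:R) ^+ 2 <= (\sum_l \1_(A l) w - lam) ^+ 2.
  by move=> h; rewrite -[leRHS]sqrrN opprB lerXn2r ?nnegrE //; lra.
move=> /(_ H); have : 0 <= (lam - n%:R) ^+ 2 by exact: sqr_ge0.
nra.
Qed.

End mean.

(** * Order statistics of independent random variables *)

(* The integral of a nonnegative function is a supremum over the simple
   functions below it. *)
Lemma le_expectation_ge0 {d : measure_display} {T : measurableType d} {R : realType}
    (P : probability T R) (X Z : T -> R) :
  (forall w, 0 <= X w <= Z w) -> ('E_P[X] <= 'E_P[Z])%E.
Proof.
move=> XZ; have X0 w : 0 <= X w by case/andP: (XZ w).
have Z0 w : 0 <= Z w by case/andP: (XZ w) => /le_trans; exact.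
rewrite unlock !ge0_integralTE => [|w|w]; rewrite ?lee_fin //.
apply: le_ereal_sup => _ [h hX <-]; exists h => // w.
by rewrite (le_trans (hX w)) // lee_fin; case/andP: (XZ w).
Qed.

(* The laws of [Y] under [P] restricted to [A] and under [P] scaled by [P A]
   coincide. *)
Lemma mean_mul_indic_indep {d : measure_display} {T : measurableType d} {R : realType}
    (P : probability T R) (Y : {RV P >-> R}) (A : set T) (g : R -> R) :
  measurable A -> measurable_fun setT g -> (forall y, 0 <= g y) ->
  (forall C, measurable C -> P (Y @^-1` C `&` A) = (P (Y @^-1` C) * P A)%E) ->
  integ P (g \o Y) ->
  mean P (fun w => g (Y w) * \1_A w) = mean P (g \o Y) * fine (P A).
Proof.
move=> mA mg g0 YA iY.
have mEg : measurable_fun setT (EFin \o g) by exact/measurable_EFinP.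
have mEgY : measurable_fun setT (EFin \o (g \o Y)) by exact: (measurable_int P iY).
have Eg0 y : (0 <= (EFin \o g) y)%E by rewrite lee_fin.
have PA_ge0 : 0 <= fine (P A) by rewrite fine_ge0.
rewrite /mean -[fine (P A)]/(fine (fine (P A))%:E) fineK ?fin_num_measure //.
rewrite -fineM ?fin_num_measure //; last by rewrite -EFin_mean.
congr fine; rewrite unlock.
transitivity (\int[P]_(w in A) (g (Y w))%:E)%E.
  rewrite [RHS]integral_mkcond; apply: eq_integral => w _.
  by rewrite patchE indicE; case: (w \in A); rewrite ?mulr1 ?mulr0.
(* The restricted measure does not charge the complement of [A], so the integral may be taken over
   the whole space and pushed forward by [Y]. *)
transitivity (\int[mrestr P mA]_w (g (Y w))%:E)%E.
  have N0 : mrestr P mA (~` A) = 0%E by rewrite /mrestr setICl measure0.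
  rewrite [RHS](ge0_negligible_integral (measurableC mA) measurableT mEgY _ N0) //;
    last by move=> w _; exact: Eg0.
  rewrite setTD setCK; apply: eq_measure_integral => B mB BA.
  by rewrite /= /mrestr setIidl.
have mY : measurable_fun setT Y by exact: measurable_funP.
have push (nu : {measure set T -> \bar R}) :=
  @ge0_integral_pushforward _ _ _ _ _ _ mY nu setT (EFin \o g) measurableT mEg
    (fun y _ => Eg0 y).
rewrite -[LHS](push (mrestr P mA)).
rewrite (eq_measure_integral (mscale (NngNum PA_ge0) (distribution P Y))); last first.
  move=> C mC _; rewrite /= /mscale /= /distribution /pushforward /mrestr /= YA //.
  by rewrite muleC fineK ?fin_num_measure.
rewrite ge0_integral_mscale // [X in (_ * X)%E](push P).
by rewrite /= fineK ?fin_num_measure // muleC.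
Qed.

Section order_statistics.
Context {d : measure_display} {T : measurableType d} {R : realType}
  {P : probability T R} {m : nat} {Y : 'I_m -> {RV P >-> R}}.
Hypotheses (Y_independent : mutually_independent Y)
  (Y_nonneg : forall i w, 0 <= Y i w)
  (Y_integrable : forall i, P.-integrable setT (EFin \o Y i)).

(** Independence for [l |: J], with the family [B] overridden by [C] at [l], and independence for
    [J] share all factors but one. *)
Lemma indep_insert (J : {set 'I_m}) (l : 'I_m) (B : 'I_m -> set R) (C : set R) :
  l \notin J -> (forall i, measurable (B i)) -> measurable C ->
  P (Y l @^-1` C `&` \bigcap_(i in [set` J]) Y i @^-1` B i) =
  (P (Y l @^-1` C) * P (\bigcap_(i in [set` J]) Y i @^-1` B i))%E.
Proof.
move=> lJ mB mC; pose B' i := if i == l then C else B i.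
have mB' i : measurable (B' i) by rewrite /B'; case: ifP.
have ne_l i : i \in J -> (i == l) = false.
  by move=> iJ; apply/negbTE/eqP => il; move: lJ; rewrite -il iJ.
have := Y_independent (l |: J)%SET B' mB'.
rewrite finset.big_setU1 //= {2}/B' eqxx.
rewrite (eq_bigr (fun i => P (Y i @^-1` B i))); last first.
  by move=> i iJ; rewrite /B' ne_l.
rewrite -Y_independent // => <-; congr (P _); apply/seteqP; split => w /=.
  move=> [wl wJ] i /=; rewrite finset.in_setU1 /B'; case: eqP => [->//|_] /= iJ.
  exact: wJ.
move=> h; split => [|i /= iJ].
  by have := h l; rewrite /= finset.in_setU1 /B' eqxx; exact.
by have := h i; rewrite /= finset.in_setU1 iJ orbT /B' ne_l //; exact.
Qed.

Lemma indep_pair (l k : 'I_m) (C B : set R) : l != k ->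
  measurable C -> measurable B ->
  P (Y l @^-1` C `&` Y k @^-1` B) = (P (Y l @^-1` C) * P (Y k @^-1` B))%E.
Proof.
move=> lk mC mB.
have := @indep_insert [set k]%SET l (fun=> B) C.
rewrite finset.in_set1 (_ : \bigcap_(i in _) _ = Y k @^-1` B); first exact.
apply/seteqP; split => w /= => [h|wB i /=].
  by apply: (h k); rewrite /= finset.in_set1.
by rewrite finset.in_set1 => /eqP ->.
Qed.

Definition stat (j : nat) (w : T) : R := order_stat (random_vector Y w) j.
Definition above (t : R) (l : 'I_m) : set T := [set w | t < Y l w].
Definition number_above (t : R) (w : T) : R := \sum_l \1_(above t l) w.

Lemma random_vector_ge0 w i : 0 <= random_vector Y w ord0 i.
Proof. by rewrite mxE. Qed.

Lemma aboveE t l : above t l = Y l @^-1` `]t, +oo[.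
Proof. by apply/seteqP; split => w /=; rewrite in_itv /= andbT. Qed.

Lemma measurable_above t l : measurable (above t l).
Proof. by apply: measurable_set_gt; exact: measurable_funP. Qed.

Lemma above_indep t l k : l != k ->
  P (above t l `&` above t k) = (P (above t l) * P (above t k))%E.
Proof. by move=> lk; rewrite !aboveE indep_pair //; exact: measurable_itv. Qed.

Lemma number_aboveE t w : number_above t w = (count_above (random_vector Y w) t)%:R.
Proof.
rewrite /count_above -sum1_card natr_sum [RHS]big_mkcond; apply: eq_bigr => l _ /=.
rewrite indicE !inE mxE; case: ifPn => [h|/negP h]; first by rewrite mem_set.
by rewrite memNset.
Qed.

Lemma measurable_number_above t : measurable_fun setT (number_above t).
Proof.
apply: (integ_measurable P); apply: integ_sum => l.
exact/integ_indic/measurable_above.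
Qed.

Lemma lt_stat t j w : 0 <= t -> (t < stat j w) = (j%:R < number_above t w).
Proof. by move=> t0; rewrite /stat lt_order_stat // number_aboveE ltr_nat. Qed.

Lemma stat_ge0 j w : 0 <= stat j w.
Proof. exact/order_stat_ge0/random_vector_ge0. Qed.

(** It suffices to test open upper rays: for [0 <= t] the preimage is an event about the count above
    [t], for [t < 0] it is everything. *)
Lemma measurable_stat j : measurable_fun setT (stat j).
Proof.
move=> mT; apply: (measurability _ (RGenOInfty.measurableE R)) => //.
move=> /= _ [_ [t ->] <-]; rewrite setTI.
have [t0|t0] := leP 0 t.
  rewrite (_ : _ @^-1` _ = [set w | j%:R < number_above t w]).
    exact/measurable_set_gt/measurable_number_above.
  by apply/seteqP; split => w /=; rewrite in_itv /= andbT lt_stat.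
rewrite (_ : _ @^-1` _ = setT) //; apply/seteqP; split => w //= _.
by rewrite in_itv /= andbT (lt_le_trans t0) // stat_ge0.
Qed.

(** No coordinate exceeds the sum of all coordinates, so this sum is an integrable majorant of every
    order statistic. *)
Lemma integ_stat j : integ P (stat j).
Proof.
apply: (@le_integ _ _ _ _ _ (fun w => \sum_l Y l w)); first exact: measurable_stat.
  move=> w; rewrite stat_ge0 /= leNgt lt_stat ?sumr_ge0 // -leNgt.
  rewrite (_ : number_above _ _ = 0) // /number_above big1 // => l _.
  rewrite indicE memNset //= => /lt_geF; rewrite (bigD1 l) //= lerDl.
  by rewrite sumr_ge0.
by apply: integ_sum => l; exact: Y_integrable.
Qed.

Definition mean_stat (j : nat) : R := mean P (stat j).

Lemma mean_stat_ge0 j : 0 <= mean_stat j.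
Proof. by apply: mean_ge0 => w; exact: stat_ge0. Qed.

Lemma mean_stat_nincr j k : (j <= k)%N -> mean_stat k <= mean_stat j.
Proof.
move=> jk; apply: le_mean => [||w]; try exact: integ_stat.
exact/order_stat_nincr/jk/random_vector_ge0.
Qed.

Lemma expected_order_statisticsE : expected_order_statistics Y = \row_(j < m) mean_stat j.
Proof.
apply/rowP => j; rewrite !mxE; congr (fine (expectation P _)).
by apply/funext => w; rewrite sort_decreasingE.
Qed.

Lemma prob_number_above_le j : 1 / 2 <= fine (P [set w | number_above (2 * mean_stat j) w <= j%:R]).
Proof.
have mC : measurable [set w | 2 * mean_stat j < stat j w].
  exact/measurable_set_gt/measurable_stat.
rewrite (_ : [set w | _] = ~` [set w | 2 * mean_stat j < stat j w]).
  rewrite probability_setC // fineB ?fin_num_measure //=.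
  have := prob_gt_twice_mean P (stat j) (integ_stat j) (stat_ge0 j).
  rewrite -/(mean_stat j); lra.
apply/seteqP; split => w /=; rewrite lt_stat ?mulr_ge0 ?mean_stat_ge0 //.
  by rewrite leNgt => /negP.
by move/negP; rewrite -leNgt.
Qed.

Definition mean_count (t : R) : R := \sum_l fine (P (above t l)).

Lemma mean_count_le j : mean_count (2 * mean_stat j) <= 2 * j.+1%:R.
Proof.
apply: sum_prob_le => [l|l k lk|]; first exact: measurable_above.
  exact: above_indep.
exact: prob_number_above_le.
Qed.

(* The single-exceedance events have probability at least 1/2 and carry disjoint
   parts of the largest order statistic. *)
Lemma sum_mean_excess_le :
  \sum_l mean P (fun w => Num.max (Y l w - 2 * mean_stat 0) 0) <= 2 * mean_stat 0.
Proof.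
set t := 2 * mean_stat 0; have t0 : 0 <= t by rewrite mulr_ge0 ?mean_stat_ge0.
pose g (y : R) := Num.max (y - t) 0.
have g0 y : 0 <= g y by rewrite le_max lexx orbT.
have mg : measurable_fun setT g.
  by apply: measurable_maxr => //; exact: measurable_funB.
(* No coordinate other than [l] exceeds [t]; this event is independent of [Y l]. *)
pose A l := \bigcap_(i in [set` (~: [set l])%SET]) Y i @^-1` `]-oo, t].
have mA l : measurable (A l).
  apply: fin_bigcap_measurable => [|i _]; first exact: finite_finset.
  by apply: measurable_funPTI; exact: measurable_itv.
have igY l : integ P (g \o Y l).
  apply: (@le_integ _ _ _ _ _ (Y l)); last exact: Y_integrable.
    by apply: measurableT_comp => //; exact: measurable_funP.
  move=> w; rewrite g0 /= /g ge_max Y_nonneg andbT lerBlDr lerDl //.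
have igA l : integ P (fun w => g (Y l w) * \1_(A l) w).
  apply: (@le_integ _ _ _ _ _ (g \o Y l)) => //.
    apply: measurable_funM; first exact: (integ_measurable P _ (igY l)).
    exact: measurable_indic.
  move=> w; rewrite indicE /=; case: (w \in A l); rewrite ?mulr1 ?mulr0 ?lexx ?g0 //.
have half l : mean P (g \o Y l) <= 2 * mean P (fun w => g (Y l w) * \1_(A l) w).
  rewrite mean_mul_indic_indep //; last first.
    move=> C mC; apply: indep_insert => //; by rewrite !inE eqxx.
  (* [A l] contains the event that no coordinate at all exceeds [t]. *)
  have PA : 1 / 2 <= fine (P (A l)).
    apply: (le_trans (prob_number_above_le 0)); rewrite fine_le ?fin_num_measure //.
      exact/measurable_set_le/measurable_number_above.
    apply: le_measure; rewrite ?inE //; first exact/measurable_set_le/measurable_number_above.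
    move=> w /= c0 i _ /=; rewrite in_itv /= leNgt; apply/negP => ti; move: c0.
    rewrite /number_above (bigD1 i) //= indicE mem_set // leNgt.
    by rewrite (@lt_le_trans _ _ 1) // lerDl sumr_ge0.
  rewrite mulrCA ler_peMr //; first by apply: mean_ge0 => w; exact: g0.
  lra.
apply: (le_trans (ler_sum _ (fun l _ => half l))).
rewrite -mulr_sumr ler_wpM2l // -(mean_sum P) //.
apply: le_mean; [exact: integ_sum | exact: integ_stat |] => w.
(* At most one [l] can exceed [t] alone, and its excess is at most the largest order statistic; if
   there is none, all terms vanish. *)
case: (pselect (exists l, t < Y l w /\ A l w)) => [[l [tl Al]]|none].
  rewrite (bigD1 l) //= [X in _ + X]big1 => [|k kl].
    rewrite addr0 indicE mem_set // mulr1.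
    apply: (@le_trans _ _ (Y l w)); first by rewrite ge_max Y_nonneg andbT lerBlDr lerDl.
    have := le_order_stat0 (random_vector Y w) l (random_vector_ge0 w).
    by rewrite mxE.
  have lk : l \in (~: [set k])%SET by rewrite !inE eq_sym kl.
  rewrite indicE memNset ?mulr0 // => Ak.
  by have := Ak l lk; rewrite /= in_itv /= leNgt tl.
rewrite big1 ?stat_ge0 // => l _.
case: (ltP t (Y l w)) => tl; last by rewrite /g max_r ?mul0r // subr_le0.
rewrite indicE memNset ?mulr0 // => Al; apply: none; by exists l.
Qed.

(** * A random factor that controls the counts at all dyadic ranks *)

Definition deviation (t : R) (w : T) : R := (number_above t w - mean_count t) ^+ 2.

Lemma integ_deviation t : integ P (deviation t).
Proof.
exact: (variance_count_le P _ (above t) (measurable_above t) (above_indep t)).1.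
Qed.

Lemma mean_deviation_le t : mean P (deviation t) <= mean_count t.
Proof.
exact: (variance_count_le P _ (above t) (measurable_above t) (above_indep t)).2.
Qed.

(** Ranks start at 0, so the rank [2 ^ i] counted from 1 has index [2 ^ i - 1]. *)
Definition threshold (i : nat) : R := 2 * mean_stat (2 ^ i).-1.

(** This is the factor [W]. With [s = 2 ^ i], the constant 3 covers the mean count [2 * s] and the
    slack [s]; the weight [1 / (4 * s ^ 2)] turns into [1 / (4 * s)] after multiplication by [s]. *)
Definition crowding (w : T) : R :=
  3 + \sum_(i < m) (4 * 4 ^+ i)^-1 * deviation (threshold i) w.

Lemma crowding_ge0 w : 0 <= crowding w.
Proof.
rewrite addr_ge0 // sumr_ge0 // => i _.
by rewrite mulr_ge0 ?sqr_ge0 // invr_ge0 mulr_ge0 // exprn_ge0.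
Qed.

Lemma integ_crowding : integ P crowding.
Proof.
apply: integD; first exact: integ_cst.
by apply: integ_sum => i; exact/integZ/integ_deviation.
Qed.

Lemma mean_count_threshold i : mean_count (threshold i) <= 2 * 2 ^+ i.
Proof.
by rewrite (le_trans (mean_count_le _)) // prednK ?expn_gt0 // natrX.
Qed.

(* [x <= s + x ^ 2 / (4 s)] with [s = 2 ^ i] trades the maximum over [i] of the
   normalised deviations for a sum of second moments. *)
Lemma number_above_threshold_le i w : (i < m)%N ->
  number_above (threshold i) w <= crowding w * 2 ^+ i.
Proof.
move=> im; have s0 : 0 < 2 ^+ i :> R by rewrite exprn_gt0.
have le_crowding : 3 + (4 * 4 ^+ i)^-1 * deviation (threshold i) w <= crowding w.
  rewrite /crowding lerD2l (bigD1 (Ordinal im)) //= lerDl sumr_ge0 // => k _.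
  by rewrite mulr_ge0 ?sqr_ge0 // invr_ge0 mulr_ge0 // exprn_ge0.
apply: (@le_trans _ _ ((3 + (4 * 4 ^+ i)^-1 * deviation (threshold i) w) * 2 ^+ i)); last first.
  by rewrite ler_wpM2r // ltW.
have := mean_count_threshold i; rewrite /deviation.
set lam := mean_count _; set S := number_above _ _.
have -> : 4 ^+ i = 2 ^+ i * 2 ^+ i :> R by rewrite -exprMn; congr (_ ^+ _); ring.
set s := 2 ^+ i in s0 *; move=> lam_le.
have -> : (3 + (4 * (s * s))^-1 * (S - lam) ^+ 2) * s =
    3 * s + (S - lam) ^+ 2 / (4 * s) by field; rewrite gt_eqF.
have : 0 <= (S - lam - 2 * s) ^+ 2 / (4 * s).
  by rewrite divr_ge0 ?sqr_ge0 // mulr_ge0 // ltW.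
have -> : (S - lam - 2 * s) ^+ 2 / (4 * s) = (S - lam) ^+ 2 / (4 * s) - (S - lam) + s.
  by field; rewrite gt_eqF.
lra.
Qed.

Lemma sum_geometric_half (n : nat) : \sum_(i < n) (2 ^+ i)^-1 = 2 - 2 / 2 ^+ n :> R.
Proof.
elim: n => [|n IH]; first by rewrite big_ord0 expr0; lra.
have s0 : 2 ^+ n != 0 :> R by rewrite expf_neq0.
by rewrite big_ord_recr /= IH exprS; field.
Qed.

(** The variance is at most [2 * 2 ^ i], so the weighted terms have means at most [1 / (2 * 2 ^ i)],
    which sum to less than 1. *)
Lemma mean_crowding_le : mean P crowding <= 4.
Proof.
have iterm i : integ P (fun w => (4 * 4 ^+ i)^-1 * deviation (threshold i) w).
  exact/integZ/integ_deviation.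
rewrite /crowding meanD ?mean_cst; [|exact: integ_cst | exact: integ_sum].
rewrite mean_sum //.
apply: (@le_trans _ _ (3 + \sum_(i < m) 2^-1 * (2 ^+ i)^-1)); last first.
  rewrite -mulr_sumr sum_geometric_half.
  have : 0 <= (2 ^+ m)^-1 :> R by rewrite invr_ge0 exprn_ge0.
  lra.
rewrite lerD2l ler_sum // => i _; rewrite meanZ; last exact: integ_deviation.
have s0 : 0 < 2 ^+ i :> R by rewrite exprn_gt0.
have -> : 4 ^+ i = 2 ^+ i * 2 ^+ i :> R by rewrite -exprMn; congr (_ ^+ _); ring.
have := le_trans (mean_deviation_le (threshold i)) (mean_count_threshold i).
set s := 2 ^+ i in s0 *; move=> h.
have -> : 2^-1 * s^-1 = (4 * (s * s))^-1 * (2 * s) by field; rewrite gt_eqF.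
by rewrite ler_wpM2l // invr_ge0 mulr_ge0 // mulr_ge0 // ltW.
Qed.

End order_statistics.

(** * Comparison of the expected norm with the norm of the expected order statistics *)

Theorem theorem5p1 (d : measure_display) (T : measurableType d) (R : realType)
    (P : probability T R) (m : nat) (Y : 'I_m -> {RV P >-> R})
    (f : 'rV[R]_m -> R)
    (Y_independent : mutually_independent Y)
    (Y_nonneg : forall i w, 0 <= Y i w)
    (Y_integrable : forall i, P.-integrable setT (EFin \o Y i))
    (f_norm : is_norm f) (f_monotone : monotone_norm f)
    (f_symmetric : symmetric_norm f) :
  ((f (expected_order_statistics Y))%:E <= 'E_P[fun w => f (random_vector Y w)])%E
  /\
  ('E_P[fun w => f (random_vector Y w)]
     <= 28%:E * (f (expected_order_statistics Y))%:E)%E.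
Proof.
have Yw_ge0 w i : 0 <= random_vector Y w ord0 i by exact: random_vector_ge0.
rewrite expected_order_statisticsE; set x := \row__ _.
have fx0 : 0 <= f x by exact: (norm_nonneg f_norm).
split.
  have f_sub : sublinear f.
    split=> [a y a0|]; last exact: (norm_triangle f_norm).
    by rewrite (norm_homogeneous f_norm) ger0_norm.
  have [c [cf cx]] := sublinear_support f x f_sub.
  pose L w := \sum_i c i * stat (Y := Y) i w.
  have iL : integ P L by apply: integ_sum => i; exact/integZ/integ_stat.
  have iabs : integ P (fun w => `|L w|) by exact: integrable_norm.
  (* The comparison of expectations wants a nonnegative minorant; the positive part of [L] stays
     below [f] because [f] is nonnegative. *)
  have imax : integ P (fun w => Num.max (L w) 0).
    apply: (@le_integ _ _ _ _ _ (fun w => `|L w|)); last exact: iabs.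
      by apply: measurable_maxr => //; exact: (integ_measurable P).
    move=> w; rewrite le_max lexx orbT /= ge_max ler_norm normr_ge0 //.
  apply: (@le_trans _ _ (mean P (fun w => Num.max (L w) 0))%:E).
    rewrite lee_fin (le_trans cx) //.
    apply: (@le_trans _ _ (mean P L)); last first.
      by apply: le_mean => // w; rewrite le_max lexx.
    rewrite mean_sum => [|i]; last exact/integZ/integ_stat.
    by apply: ler_sum => i _; rewrite meanZ ?mxE //; exact: integ_stat.
  rewrite EFin_mean //; apply: le_expectation_ge0 => w.
  rewrite le_max lexx orbT /= ge_max (norm_nonneg f_norm) andbT.
  rewrite f_symmetric // (le_trans _ (cf _)) //.
  by apply: ler_sum => i _; rewrite sort_decreasingE.
pose F := unit_norm (f := f).
pose excess l w := Num.max (Y l w - 2 * mean_stat (Y := Y) 0) 0.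
(* An integrable pointwise majorant of [f]: [(2 * W + 1) * f (2 * mu)] for the truncated vector,
   expanded, plus the cost of the excess. *)
pose H w := (4 * f x) * crowding (Y := Y) w + (2 * f x + F * \sum_l excess l w).
have iexcess l : integ P (excess l).
  apply: (@le_integ _ _ _ _ _ (Y l)); last exact: Y_integrable.
    by apply: measurable_maxr => //; exact: measurable_funB.
  move=> w; rewrite le_max lexx orbT /= ge_max Y_nonneg andbT lerBlDr lerDl.
  by rewrite mulr_ge0 ?mean_stat_ge0.
have isum : integ P (fun w => F * \sum_l excess l w).
  by apply: integZ; exact: integ_sum.
have icrowd : integ P (fun w => (4 * f x) * crowding (Y := Y) w).
  by apply: integZ; exact: integ_crowding.
have irest : integ P (fun w => 2 * f x + F * \sum_l excess l w).
  by apply: integD; [exact: integ_cst | exact: isum].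
have iH : integ P H by exact: integD.
have F0 : 0 <= F by exact: (norm_nonneg f_norm).
apply: (@le_trans _ _ (mean P H)%:E); last first.
  rewrite -EFinM lee_fin /H (meanD P _ _ icrowd irest) meanZ; last exact: integ_crowding.
  rewrite (meanD P _ _ (integ_cst P _) isum) mean_cst.
  rewrite meanZ ?mean_sum //; last exact: integ_sum.
  (* The three parts of [H] contribute 16, 2 and 2 times [f x], so 28 is reached with room to
     spare. *)
  have hW : 4 * f x * mean P (crowding (Y := Y)) <= 4 * f x * 4.
    by rewrite ler_wpM2l ?mulr_ge0 ?mean_crowding_le.
  have hE : F * \sum_l mean P (excess l) <= F * (2 * mean_stat (Y := Y) 0).
    by rewrite ler_wpM2l ?sum_mean_excess_le.
  have hF : mean_stat (Y := Y) 0 * F <= f x.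
    by apply: (unit_norm_le f_norm f_monotone) => j; exact: mean_stat_ge0.
  lra.
rewrite EFin_mean //; apply: le_expectation_ge0 => w.
rewrite (norm_nonneg f_norm) /=.
rewrite (le_trans (norm_truncate f_norm f_monotone f_symmetric _ (2 * mean_stat (Y := Y) 0))) //.
have h2x : f (\row_(j < m) (2 * mean_stat (Y := Y) j)) = 2 * f x.
  rewrite -[2 in RHS](@ger0_norm R) // -(norm_homogeneous f_norm); congr f.
  by apply/rowP => j; rewrite !mxE.
have := @norm_truncated_le R m f f_norm f_monotone f_symmetric (random_vector Y w)
  (fun j => 2 * mean_stat (Y := Y) j) (crowding (Y := Y) w) (Yw_ge0 w).
rewrite h2x => /(_ _ _ _ _)-h.
rewrite /H addrA lerD //; last first.
  by rewrite mulrC ler_wpM2l // ler_sum // => l _; rewrite mxE.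
have -> : 4 * f x * crowding (Y := Y) w + 2 * f x = (2 * crowding (Y := Y) w + 1) * (2 * f x) by ring.
apply: h => [j|j k jk||i im].
- by rewrite mulr_ge0 ?mean_stat_ge0.
- by rewrite ler_wpM2l // mean_stat_nincr.
- exact: crowding_ge0.
- by rewrite -number_aboveE number_above_threshold_le.
Qed.
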